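(* The group $\mathrm{Homeo}^+(\mathbb{S}^1)$ can be partitioned into a Haar null set and a meagre set.
   Context: $\mathbb{S}^1=\mathbb{R}/\mathbb{Z}$, and $\mathrm{Homeo}^+(\mathbb{S}^1)$ is the Polish group (under composition) of orientation preserving homeomorphisms of $\mathbb{S}^1$ with the uniform topology. Haar null sets (Christensen): in a Polish group $G$, a Borel set $B\subset G$ is Haar null if there is a Borel probability measure $\mu$ on $G$ such that $\mu(gBh)=0$ for all $g,h\in G$; an arbitrary set $S \subset G$ is Haar null if it is contained in a Borel Haar null set. *)

(* Defs.v *)
From HB Require Import structures.
From mathcomp Require Import all_boot all_order all_algebra archimedean.
From mathcomp Require Import all_classical all_reals all_analysis.
From mathcomp Require Import lra.

Set Implicit Arguments.
Unset Strict Implicit.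
Unset Printing Implicit Defensive.

Import Order.TTheory GRing.Theory Num.Theory.
Import numFieldNormedType.Exports.

Local Open Scope classical_set_scope.
Local Open Scope ring_scope.

(* The quotient of the additive group R by the subgroup Num.int of integers. *)
Definition circle (R : realType) : Type :=
  Quotient.quot (GRing.ZmodClosed.clone R (@Num.int_num_subdef R) _).

HB.instance Definition _ (R : realType) := GRing.Zmodule.on (circle R).

Definition circle_proj (R : realType) (t : R) : circle R :=
  (\pi_(Quotient.quot (GRing.ZmodClosed.clone R (@Num.int_num_subdef R) _)) t)%qT.

Section CircleMetric.
Variable R : realType.
Implicit Types (x y z : circle R) (s t : R).

Lemma circle_proj_surj x : exists t, circle_proj t = x.
Proof. by exists (repr (x : Quotient.quot _)); exact: reprK. Qed.

Lemma circle_projP s t : circle_proj s = circle_proj t <-> s - t \is a Num.int.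
Proof.
rewrite (_ : s - t \is a Num.int = (s - t \in 
  GRing.ZmodClosed.clone R (@Num.int_num_subdef R) _)) // Quotient.idealrBE.
by split => /eqP.
Qed.

(* The quotient metric; the set is nonempty and bounded below by 0, so this   *)
(* is a genuine infimum.                                                      *)
Definition circle_dist x y : R :=
  inf [set `|s - t| | s in [set s | circle_proj s = x]
                    & t in [set t | circle_proj t = y]].

Lemma circle_dist_ltP x y e : circle_dist x y < e <->
  exists s t, [/\ circle_proj s = x, circle_proj t = y & `|s - t| < e].
Proof.
have [s0 xs0] := circle_proj_surj x; have [t0 yt0] := circle_proj_surj y.
rewrite /circle_dist; set E := (X in inf X).
have E0 : E !=set0 by exists `|s0 - t0|; exists s0 => //; exists t0.
have lE : has_lbound E by exists 0 => _ [s _ [t _ <-]]; exact: normr_ge0.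
split=> [/(inf_lt E0)[_ [s xs [t yt <-]] ste]|[s [t [xs yt ste]]]].
  by exists s, t.
by apply: le_lt_trans ste; apply: (ge_inf lE); exists s => //; exists t.
Qed.

Lemma circle_dist_ge0 x y : 0 <= circle_dist x y.
Proof.
rewrite leNgt; apply/negP => /circle_dist_ltP[s [t [_ _]]].
by rewrite normr_lt0.
Qed.

Lemma circle_distxx x : circle_dist x x = 0.
Proof.
apply/eqP; rewrite eq_le circle_dist_ge0 andbT.
apply/ler_addgt0Pl => e e0; rewrite addr0; apply: ltW.
have [s xs] := circle_proj_surj x.
by apply/circle_dist_ltP; exists s, s; rewrite subrr normr0.
Qed.

Lemma circle_dist_sym x y : circle_dist x y = circle_dist y x.
Proof.
wlog suff H : x y / circle_dist y x <= circle_dist x y.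
  by apply/eqP; rewrite eq_le !H.
apply/ler_addgt0Pl => e e0; apply: ltW; apply/circle_dist_ltP.
have /circle_dist_ltP[s [t [xs yt ste]]] : circle_dist x y < e + circle_dist x y.
  by rewrite ltrDr.
by exists t, s; split => //; rewrite distrC.
Qed.

Lemma circle_dist_triangle y x z :
  circle_dist x z <= circle_dist x y + circle_dist y z.
Proof.
apply/ler_addgt0Pl => e e0; apply: ltW; apply/circle_dist_ltP.
have e20 : 0 < e / 2 by rewrite divr_gt0.
have /circle_dist_ltP[s [t [xs yt st]]] :
  circle_dist x y < e / 2 + circle_dist x y by rewrite ltrDr.
have /circle_dist_ltP[s' [t' [ys' zt' st']]] :
  circle_dist y z < e / 2 + circle_dist y z by rewrite ltrDr.
have ts' : t - s' \is a Num.int by apply/circle_projP; rewrite yt ys'.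
exists s, (t' + (t - s')); split => //.
  by rewrite -zt'; apply/circle_projP; rewrite addrAC subrr add0r.
rewrite (_ : s - _ = (s - t) + (s' - t')); last by lra.
by apply: le_lt_trans (ler_normD _ _) _; lra.
Qed.

Lemma circle_dist_eq0 x y : circle_dist x y = 0 -> x = y.
Proof.
move=> xy0.
have [s0 xs0] := circle_proj_surj x; have [t0 yt0] := circle_proj_surj y.
have near0 e : 0 < e -> exists2 d, d \is a Num.int & `|s0 - t0 - d| < e.
  move=> e0; have /circle_dist_ltP[s [t [xs yt st]]] : circle_dist x y < e.
    by rewrite xy0.
  have /circle_projP di : circle_proj s0 = circle_proj s by rewrite xs0 xs.
  have /circle_projP d'i : circle_proj t0 = circle_proj t by rewrite yt0 yt.
  exists ((s0 - s) - (t0 - t)); first exact: rpredB.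
  by rewrite (_ : _ - _ = s - t) //; lra.
have [|d di dl] := near0 2^-1; first by rewrite invr_gt0.
suff e0 : s0 - t0 = d by rewrite -xs0 -yt0; apply/circle_projP; rewrite e0.
apply/eqP; rewrite -subr_eq0 -normr_le0; apply/ler_addgt0Pl => e e0.
rewrite addr0; have [|d' d'i d'l] := near0 (Num.min e 2^-1).
  by rewrite lt_min e0 /= invr_gt0 ltr0n.
move: d'l; rewrite lt_min => /andP[d'e d'l].
suff -> : d = d' by exact: ltW.
apply/eqP; rewrite -subr_eq0; apply: contraT => dd'.
have : 1 <= `|d - d'| by apply: norm_intr_ge1 => //; exact: rpredB.
rewrite (_ : d - d' = (s0 - t0 - d') - (s0 - t0 - d)); last by lra.
by have := ler_normB (s0 - t0 - d') (s0 - t0 - d); lra.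
Qed.

HB.instance Definition _ := isMetric.Build R (circle R)
  circle_distxx circle_dist_eq0 circle_dist_sym circle_dist_triangle.

End CircleMetric.

Definition homeomorphism (T : topologicalType) (f : T -> T) : Prop :=
  continuous f /\ exists g, [/\ continuous g, cancel f g & cancel g f].

Section HomeoPlus.
Variable R : realType.
Implicit Types f g : circle R -> circle R.

(* f has a continuous strictly increasing lift to the universal cover R; it   *)
(* commutes with the deck transformation t |-> t + 1.                         *)
Definition orientation_preserving f : Prop := exists F : R -> R,
  [/\ continuous F, {homo F : s t / s < t}, forall t, F (t + 1) = F t + 1
    & forall t, circle_proj (F t) = f (circle_proj t)].

(* Homeo^+(S^1); the topology is the one induced by uniform convergence.      *)
Definition homeo_plus : Type :=
  set_type [set f : {uniform circle R -> circle R} |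
            homeomorphism f /\ orientation_preserving f].

HB.instance Definition _ := Uniform.on homeo_plus.

Definition homeo_fun (f : homeo_plus) : circle R -> circle R := set_val f.

Lemma homeo_nbhsP (f : homeo_plus) (U : set homeo_plus) :
  nbhs f U <-> exists2 e : R, 0 < e & forall g : homeo_plus,
    (forall x, circle_dist (homeo_fun f x) (homeo_fun g x) < e) -> U g.
Proof.
rewrite -nbhs_entourageE /nbhs_ /=; split.
  case=> A [B]; rewrite uniform_entourage => -[C].
  rewrite -entourage_ballE => -[e /= e0 eC] CB BA AU.
  exists e => // g fg; apply: AU; apply/xsectionP; apply: BA; apply: CB => /= t _.
  by apply: eC => /=; exact: fg.
case=> e e0 H; exists [set fg : homeo_plus * homeo_plus |
  forall x, circle_dist (homeo_fun fg.1 x) (homeo_fun fg.2 x) < e]; last first.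
  by move=> g /xsectionP /H.
exists [set fg : {uniform circle R -> circle R} * {uniform circle R -> circle R} |
  forall x, circle_dist (fg.1 x) (fg.2 x) < e] => //.
rewrite uniform_entourage; exists [set p | circle_dist p.1 p.2 < e].
  by rewrite -entourage_ballE; exists e.
by move=> [a b] /= H1 x; exact: H1.
Qed.

End HomeoPlus.

Lemma homeomorphism_comp (T : topologicalType) (f g : T -> T) :
  homeomorphism f -> homeomorphism g -> homeomorphism (f \o g).
Proof.
move=> [cf [f' [cf' fK f'K]]] [cg [g' [cg' gK g'K]]]; split.
  by move=> x; apply: continuous_comp; [exact: cg|exact: cf].
exists (g' \o f'); split; [|exact: can_comp|exact: can_comp].
by move=> x; apply: continuous_comp; [exact: cf'|exact: cg'].
Qed.

Section LiftInverse.
Variables (R : realType) (F : R -> R).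
Hypotheses (cF : continuous F) (incF : {homo F : s t / s < t}).
Hypothesis F1 : forall t, F (t + 1) = F t + 1.

Let Fn t n : F (t + n%:R) = F t + n%:R.
Proof.
elim: n => [|n IH]; first by rewrite !addr0.
by rewrite -natr1 addrA F1 IH addrA.
Qed.

Let Fsurj y : exists t, F t = y.
Proof.
pose n := Num.bound `|y - F 0|.
have yn : `|y - F 0| < n%:R by exact: archi_boundP.
have n0 : 0 <= n%:R :> R by [].
have FN : F (- n%:R) = F 0 - n%:R.
  by rewrite -[in RHS](addNr n%:R) Fn addrK.
have FP : F n%:R = F 0 + n%:R by rewrite -Fn add0r.
have nn : - n%:R <= n%:R :> R by lra.
have [||t _ <-] := @IVT _ F _ _ y nn; last by exists t.
  exact: continuous_subspaceT.
move: yn; rewrite ltr_norml => /andP[yn1 yn2].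
by rewrite FN FP ge_min le_max; apply/andP; split; apply/orP; [left|right]; lra.
Qed.

Lemma lift_inverse : exists G : R -> R,
  [/\ continuous G, {homo G : s t / s < t}, forall t, G (t + 1) = G t + 1
    & cancel G F].
Proof.
have [G GK] := choice Fsurj.
have lF : {mono F : s t / s <= t} by exact: le_mono.
have ltF : {mono F : s t / s < t} by exact: leW_mono.
have FK : cancel F G by move=> t; apply: (inc_inj lF); rewrite GK.
have incG : {homo G : s t / s < t} by move=> s t st; rewrite -ltF !GK.
exists G; split => //; last first.
  by move=> t; apply: (inc_inj lF); rewrite F1 !GK.
move=> x; apply/cvgrPdist_lt => e e0; near=> y.
rewrite ltr_distlC; apply/andP; split; rewrite -ltF GK.
  near: y; apply: (@cvgr_gt _ _ (nbhs x) _ id x cvg_id).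
  by rewrite -[ltRHS]GK ltF; lra.
near: y; apply: (@cvgr_lt _ _ (nbhs x) _ id x cvg_id).
by rewrite -[ltLHS]GK ltF; lra.
Unshelve. all: by end_near. Qed.

End LiftInverse.

Section HomeoPlusGroup.
Variable R : realType.
Implicit Types f g h : homeo_plus R.

Lemma orientation_preserving_comp (u v : circle R -> circle R) :
  orientation_preserving u -> orientation_preserving v ->
  orientation_preserving (u \o v).
Proof.
move=> [F [cF iF F1 uF]] [G [cG iG G1 vG]]; exists (F \o G); split.
- by move=> x; apply: continuous_comp; [exact: cG|exact: cF].
- by move=> s t /iG/iF.
- by move=> t /=; rewrite G1 F1.
- by move=> t /=; rewrite uF vG.
Qed.

Lemma orientation_preserving_inv (u v : circle R -> circle R) :
  cancel u v -> orientation_preserving u -> orientation_preserving v.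
Proof.
move=> uK [F [cF iF F1 uF]]; have [G [cG iG G1 GK]] := lift_inverse cF iF F1.
by exists G; split => // t; rewrite -[RHS]uK -[in RHS](GK t) uF uK uK.
Qed.

Lemma homeo_funP f :
  homeomorphism (homeo_fun f) /\ orientation_preserving (homeo_fun f).
Proof. by have := set_mem (valP f). Qed.

Lemma homeo_fun_inj : injective (@homeo_fun R).
Proof. exact: val_inj. Qed.

Lemma homeo_plus_ex (u : circle R -> circle R) :
  homeomorphism u /\ orientation_preserving u ->
  exists f : homeo_plus R, homeo_fun f = u.
Proof.
move=> hu.
have uP : [set v : {uniform circle R -> circle R} |
  homeomorphism v /\ orientation_preserving v] u by [].
by exists (SigSub (mem_set uP)).
Qed.

Lemma homeo_one_ex : exists f, homeo_fun f = id.
Proof.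
apply: homeo_plus_ex; split; last by exists id; split => // x; exact: cvg_id.
by split; [|exists id; split => //]; move=> x; exact: cvg_id.
Qed.

Lemma homeo_mul_ex f g : exists h, homeo_fun h = homeo_fun f \o homeo_fun g.
Proof.
have [[hf of_] [hg og]] := (homeo_funP f, homeo_funP g).
apply: homeo_plus_ex; split; first exact: homeomorphism_comp.
exact: orientation_preserving_comp.
Qed.

Lemma homeo_inv_ex f :
  exists h, cancel (homeo_fun f) (homeo_fun h) /\
            cancel (homeo_fun h) (homeo_fun f).
Proof.
have [[cf [u [cu fK uK]]] of_] := homeo_funP f.
have [|h hu] := @homeo_plus_ex u; last by exists h; rewrite hu.
split; last exact: orientation_preserving_inv of_.
by split => //; exists (homeo_fun f).
Qed.

Definition homeo_one : homeo_plus R := sval (cid homeo_one_ex).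
Definition homeo_mul f g : homeo_plus R := sval (cid (homeo_mul_ex f g)).
Definition homeo_inv f : homeo_plus R := sval (cid (homeo_inv_ex f)).

Lemma homeo_oneE : homeo_fun homeo_one = id.
Proof. exact: svalP (cid homeo_one_ex). Qed.

Lemma homeo_mulE f g : homeo_fun (homeo_mul f g) = homeo_fun f \o homeo_fun g.
Proof. exact: svalP (cid (homeo_mul_ex f g)). Qed.

Lemma homeo_funK f : cancel (homeo_fun f) (homeo_fun (homeo_inv f)).
Proof. by have [] := svalP (cid (homeo_inv_ex f)). Qed.

Lemma homeo_funVK f : cancel (homeo_fun (homeo_inv f)) (homeo_fun f).
Proof. by have [] := svalP (cid (homeo_inv_ex f)). Qed.

Lemma homeo_mulA : associative homeo_mul.
Proof. by move=> f g h; apply: homeo_fun_inj; rewrite !homeo_mulE. Qed.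

Lemma homeo_mul1f : left_id homeo_one homeo_mul.
Proof. by move=> f; apply: homeo_fun_inj; rewrite homeo_mulE homeo_oneE. Qed.

Lemma homeo_mulf1 : right_id homeo_one homeo_mul.
Proof. by move=> f; apply: homeo_fun_inj; rewrite homeo_mulE homeo_oneE. Qed.

Lemma homeo_mulVf : left_inverse homeo_one homeo_inv homeo_mul.
Proof.
move=> f; apply: homeo_fun_inj; rewrite homeo_mulE homeo_oneE.
by apply/funext => x; exact: homeo_funK.
Qed.

Lemma homeo_mulfV : right_inverse homeo_one homeo_inv homeo_mul.
Proof.
move=> f; apply: homeo_fun_inj; rewrite homeo_mulE homeo_oneE.
by apply/funext => x; exact: homeo_funVK.
Qed.

HB.instance Definition _ := isPointed.Build (homeo_plus R) homeo_one.
HB.instance Definition _ := isGroup.Build (homeo_plus R)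
  homeo_mulA homeo_mul1f homeo_mulf1 homeo_mulVf homeo_mulfV.

Lemma homeo_fun1 : homeo_fun (1%g : homeo_plus R) = id.
Proof. exact: homeo_oneE. Qed.

Lemma homeo_funM f g : homeo_fun (f * g)%g = homeo_fun f \o homeo_fun g.
Proof. exact: homeo_mulE. Qed.

End HomeoPlusGroup.

Definition nowhere_dense (T : topologicalType) (A : set T) : Prop :=
  (closure A)^° = set0.

Definition meagre (T : topologicalType) (A : set T) : Prop :=
  exists2 F : (set T)^nat,
    (forall n, nowhere_dense (F n)) & A = \bigcup_n F n.

Section HaarNull.
Variable R : realType.
Implicit Types (B S : set (homeo_plus R)) (g h : homeo_plus R).

Definition homeo_borel : Type := g_sigma_algebraType (@open (homeo_plus R)).

HB.instance Definition _ := Measurable.copy homeo_borel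
  (g_sigma_algebraType (@open (homeo_plus R))).

Definition translate g B h : set (homeo_plus R) := [set (g * b * h)%g | b in B].

Definition borel_haar_null B : Prop :=
  measurable (B : set homeo_borel) /\
  exists mu : probability homeo_borel R,
    forall g h, mu (translate g B h) = 0%E.

Definition haar_null S : Prop := exists2 B, borel_haar_null B & S `<=` B.

End HaarNull.

(* Main.v *)
(* For points x_i of the circle and pairwise disjoint open sets U_i, i < r, and
   for homeomorphisms g, h, a uniformly random rotation rot satisfies
   g (rot (h x_i)) \in U_i for all i with probability O(1 / r): the events for
   fixed i have probability |g^-1 U_i|, and these sum to at most 1. On the other
   hand, if the x_i are consecutive points close to 0 and the U_i are consecutive
   arcs close to f 0, then a small perturbation of f sends each x_i into U_i.
   Running over countably many such configurations with rapidly growing r gives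
   dense open sets whose two-sided translates have arbitrarily small probability
   under the law of the random rotation; their intersection is comeagre and Haar
   null. *)
From HB Require Import structures.
Require Import Defs.
From mathcomp Require Import all_boot all_order all_algebra archimedean.
From mathcomp Require Import all_classical all_reals all_analysis.
From mathcomp Require Import measurable_realfun lra ring.

Set Implicit Arguments.
Unset Strict Implicit.
Unset Printing Implicit Defensive.

Import Order.TTheory GRing.Theory Num.Theory.
Import numFieldNormedType.Exports.

Local Open Scope classical_set_scope.
Local Open Scope ring_scope.

(** * Lifting points and maps of the circle to the real line *)

Section CircleLifts.
Variable R : realType.
Implicit Types (x y : circle R) (s t : R).

Lemma circle_projD_int s k : k \is a Num.int ->
  circle_proj (s + k) = circle_proj s :> circle R.
Proof. by move=> ki; apply/circle_projP; rewrite addrC addKr. Qed.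

Lemma circle_proj_window (a : R) x : exists2 t, circle_proj t = x & a <= t < a + 1.
Proof.
have [s sx] := circle_proj_surj x.
exists (s - (Num.floor (s - a))%:~R).
  by rewrite circle_projD_int // rpredN intr_int.
have /andP[] := real_floor_itv (num_real (s - a)).
by rewrite intrD1; set k := _%:~R; lra.
Qed.

Lemma circle_dist_proj_le s t :
  circle_dist (circle_proj s) (circle_proj t) <= `|s - t|.
Proof.
apply/ler_addgt0Pl => e e0; apply/ltW/circle_dist_ltP.
by exists s, t; split => //; rewrite ltrDr.
Qed.

(** An integer translation carries any pair of close lifts to one whose first member is [s]. *)
Lemma circle_dist_projP s x e : circle_dist (circle_proj s) x < e <->
  exists2 t, circle_proj t = x & `|s - t| < e.
Proof.
split=> [/circle_dist_ltP[s' [t [/circle_projP ss' tx st]]]|[t <- st]]; last first.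
  exact: le_lt_trans (circle_dist_proj_le _ _) st.
exists (t + (s - s')).
  by rewrite circle_projD_int // -opprB rpredN.
by rewrite (_ : _ - _ = s' - t) //; ring.
Qed.

Lemma circle_proj_continuous : continuous (@circle_proj R).
Proof.
move=> t; apply/cvg_ballP => e e0; apply/nbhs_ballP; exists e => // s ts.
exact: le_lt_trans (circle_dist_proj_le _ _) ts.
Qed.

Lemma lift_int (F : R -> R) : (forall t, F (t + 1) = F t + 1) ->
  forall t k, k \is a Num.int -> F (t + k) = F t + k.
Proof.
move=> F1 t k /intrP[m ->].
have FD u n : F (u + n%:R) = F u + n%:R.
  by elim: n => [|n IH]; rewrite ?addr0 // -natr1 addrA F1 IH addrA.
case: m => n; first by rewrite -pmulrn FD.
by rewrite NegzE mulrNz -pmulrn -[in RHS](subrK n.+1%:R t) FD addrK.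
Qed.

Lemma lift_homeo_plus (F : R -> R) : continuous F -> {homo F : s t / s < t} ->
  (forall t, F (t + 1) = F t + 1) ->
  exists f : homeo_plus R, forall t, homeo_fun f (circle_proj t) = circle_proj (F t).
Proof.
(* [sec] picks lifts with no continuity; periodicity of [G] makes [down G] independent of this
   choice, so it can be computed along any lift. *)
have [sec secK] := choice (@circle_proj_surj R).
pose down (G : R -> R) x := circle_proj (G (sec x)).
have downE G : (forall t, G (t + 1) = G t + 1) ->
    forall t, down G (circle_proj t) = circle_proj (G t).
  move=> G1 t; have /circle_projP ti := secK (circle_proj t).
  rewrite /down -[X in G X](subrK t) [X in G X]addrC (lift_int G1) //.
  exact: circle_projD_int.
have down_cont (G : R -> R) : (forall t, G (t + 1) = G t + 1) -> continuous G ->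
    continuous (down G).
  move=> G1 cG x; have [t <-] := circle_proj_surj x.
  rewrite /continuous_at downE // => U /nbhs_ballP[e /= e0 eU].
  have /cvgrPdist_lt/(_ _ e0)/nbhs_ballP[d /= d0 dG] := cG t.
  apply/nbhs_ballP; exists d => // y /circle_dist_projP[s <- ts] /=.
  rewrite downE //; apply: eU.
  by apply: le_lt_trans (circle_dist_proj_le _ _) _; exact: dG.
move=> cF iF F1; have [G [cG iG G1 GK]] := lift_inverse cF iF F1.
have FK : cancel F G.
  by move=> t; apply: (inc_inj (le_mono iF)); rewrite GK.
have [|f fF] := @homeo_plus_ex R (down F).
  split; last by exists F; split => // t; rewrite downE.
  split; first exact: down_cont.
  exists (down G); split; first exact: down_cont.
    by move=> x; have [t <-] := circle_proj_surj x; rewrite !downE // FK.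
  by move=> x; have [t <-] := circle_proj_surj x; rewrite !downE // GK.
by exists f => t; rewrite fF downE.
Qed.

End CircleLifts.

(** * Increasing homeomorphisms supported in an interval, and their periodic extension *)

Section Interpolation.
Variable R : realType.
Implicit Types (a b s t : R).

Definition supported_homeo a b (K : R -> R) : Prop :=
  [/\ continuous K, {homo K : s t / s < t}
    & forall t, ~~ (a < t < b) -> K t = t].

Lemma supported_homeo_comp a' a b (K L : R -> R) : a <= a' ->
  supported_homeo a' b K -> supported_homeo a b L -> supported_homeo a b (K \o L).
Proof.
move=> aa' [cK iK sK] [cL iL sL]; split.
- by move=> t; apply: continuous_comp; [exact: cL|exact: cK].
- by move=> s t /iL/iK.
- move=> t tab /=; rewrite sL // sK //; apply: contra tab => /andP[a't ->].
  by rewrite (le_lt_trans aa').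
Qed.

Lemma supported_homeo_point a b y z : a < y < b -> a < z < b ->
  exists2 K, supported_homeo a b K & K y = z.
Proof.
move=> /andP[ay yb] /andP[az zb].
(* These are the slopes, on [a, y] and [y, b], of the broken line that fixes [a] and [b] and sends
   [y] to [z]. *)
pose p := (z - a) / (y - a); pose q := (b - z) / (b - y).
have p0 : 0 < p by rewrite divr_gt0 // subr_gt0.
have q0 : 0 < q by rewrite divr_gt0 // subr_gt0.
have pE : p * (y - a) = z - a by rewrite divfK // subr_eq0 gt_eqF.
have qE : q * (b - y) = b - z by rewrite divfK // subr_eq0 gt_eqF.
pose L1 t := a + p * (t - a); pose L2 t := b - q * (b - t).
have cL1 : continuous L1.
  move=> t; apply: cvgD; first exact: cvg_cst.
  by apply: cvgMr; apply: cvgB; [exact: cvg_id|exact: cvg_cst].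
have cL2 : continuous L2.
  move=> t; apply: cvgB; first exact: cvg_cst.
  by apply: cvgMr; apply: cvgB; [exact: cvg_cst|exact: cvg_id].
have iL1 : {homo L1 : s t / s < t}.
  by move=> s t st; rewrite /L1 ltrD2l ltr_pM2l // ltrD2r.
have iL2 : {homo L2 : s t / s < t}.
  by move=> s t st; rewrite /L2 ltrD2l ltrN2 ltr_pM2l // ltrD2l ltrN2.
have L1y : L1 y = z by rewrite /L1 pE; ring.
have L2y : L2 y = z by rewrite /L2 qE; ring.
have [yz|zy] := leP y z.
(* Both pieces are affine through the fixed points a and b; on the appropriate
   side, taking a maximum (or minimum) with the identity undoes them outside
   [a, b]. *)
- have p1 : 1 <= p by rewrite /p ler_pdivlMr ?subr_gt0 // mul1r lerD2r.
  have q1 : q <= 1 by rewrite /q ler_pdivrMr ?subr_gt0 // mul1r lerD2l lerN2.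
  exists (id \max (L1 \min L2)); last first.
    by rewrite /= L1y L2y minxx; apply/max_idPr.
  split.
  + move=> t; apply: (@continuous_max R R id); first exact: cvg_id.
    by apply: (@continuous_min R R); [exact: cL1|exact: cL2].
  + move=> s t st; rewrite /= gt_max !lt_max st /= lt_min; apply/orP; right.
    by rewrite !gt_min (iL1 _ _ st) (iL2 _ _ st) orbT.
  + move=> t; rewrite negb_and -!leNgt => tab; apply/max_idPl.
    rewrite ge_min; case/orP: tab => h; apply/orP; [left|right].
      by rewrite /L1; nra.
    by rewrite /L2; nra.
- have p1 : p <= 1 by rewrite /p ler_pdivrMr ?subr_gt0 // mul1r lerD2r ltW.
  have q1 : 1 <= q by rewrite /q ler_pdivlMr ?subr_gt0 // mul1r lerD2l lerN2 ltW.
  exists (id \min (L1 \max L2)); last first.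
    by rewrite /= L1y L2y maxxx; apply/min_idPr/ltW.
  split.
  + move=> t; apply: (@continuous_min R R id); first exact: cvg_id.
    by apply: (@continuous_max R R); [exact: cL1|exact: cL2].
  + move=> s t st; rewrite /= lt_min !gt_min st /= gt_max; apply/orP; right.
    by rewrite !lt_max (iL1 _ _ st) (iL2 _ _ st) orbT.
  + move=> t; rewrite negb_and -!leNgt => tab; apply/min_idPl.
    rewrite le_max; case/orP: tab => h; apply/orP; [left|right].
      by rewrite /L1; nra.
    by rewrite /L2; nra.
Qed.

(** Induction on [r]: a first map sends the leftmost point to its target; the images of the others
    are then moved within the interval from that target to [b], which keeps the target fixed. *)
Lemma supported_homeo_interpolation r a b (y z : nat -> R) :
  (forall i, (i < r)%N -> a < y i < b) -> (forall i, (i < r)%N -> a < z i < b) ->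
  (forall i j, (i < j < r)%N -> y i < y j) ->
  (forall i j, (i < j < r)%N -> z i < z j) ->
  exists2 K, supported_homeo a b K & forall i, (i < r)%N -> K (y i) = z i.
Proof.
elim: r a y z => [|r IH] a y z yab zab iy iz.
  by exists id => //; split => // t; exact: cvg_id.
have [L [cL iL sL] Ly] := supported_homeo_point (yab 0%N erefl) (zab 0%N erefl).
have Lb : L b = b by rewrite sL // ltxx andbF.
have /andP[az _] := zab 0%N erefl.
have [|i ir|i j ij|i j ij|K hK Ky] :=
    IH (z 0%N) (fun i => L (y i.+1)) (fun i => z i.+1).
- move=> i ir; rewrite -Ly -[in X in _ && X]Lb; apply/andP; split; apply: iL.
    exact: iy.
  by have /andP[] := yab i.+1 ir.
- by rewrite iz //=; have /andP[] := zab i.+1 ir.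
- by apply/iL/iy.
- exact: iz.
exists (K \o L); first by apply: supported_homeo_comp hK _; [exact: ltW|split].
case=> [_|i /Ky //] /=; rewrite Ly; case: hK => _ _ -> //.
by rewrite ltxx.
Qed.

(** The interval is shorter than 1, so its integer translates are disjoint and each can carry a copy
    of [K]. *)
Lemma supported_homeo_periodic a b (K : R -> R) : a < b < a + 1 ->
  supported_homeo a b K -> exists F : R -> R,
  [/\ continuous F, {homo F : s t / s < t}, forall t, F (t + 1) = F t + 1,
      forall t, a < t < b -> F t = K t & forall t, `|F t - t| < b - a].
Proof.
move=> /andP[ab ba1] [cK iK sK].
have Ka : K a = a by apply: sK; rewrite ltxx.
have Kb : K b = b by apply: sK; rewrite ltxx andbF.
pose fl t : R := (Num.floor (t - a))%:~R.
have flE t : fl t <= t - a < fl t + 1.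
  by have := real_floor_itv (num_real (t - a)); rewrite intrD1.
have fl_int t : fl t \is a Num.int by exact: intr_int.
have intlt (m n : R) : m \is a Num.int -> n \is a Num.int -> m < n -> m + 1 <= n.
  move=> /intrP[m' ->] /intrP[n' ->]; rewrite ltr_int -intrD1 ler_int.
  by rewrite lezD1.
pose F t := K (t - fl t) + fl t.
(* The window for [t - k] is longer than a period: where two values of [k] qualify, both formulas
   give the identity. Hence [k] can stay constant near [t], and the jumps of the floor do no harm to
   continuity. *)
have FE t k : k \is a Num.int -> b - 1 < t - k < a + 1 -> F t = K (t - k) + k.
  move=> ki /andP[h1 h2]; have /andP[h3 h4] := flE t.
  have [kf|fk|->//] := ltgtP k (fl t).
    by have := intlt _ _ ki (fl_int t) kf; lra.
  have := intlt _ _ (fl_int t) ki fk => h5.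
  have h6 : fl t + 1 = k.
    have [h|] := ltP (fl t + 1) k; last by lra.
    have : fl t + 1 + 1 <= k by apply: intlt => //; rewrite rpredD ?rpred1.
    by lra.
  rewrite /F !sK; first lra.
    by rewrite negb_and -!leNgt; apply/orP; left; lra.
  by rewrite negb_and -!leNgt; apply/orP; right; lra.
have Fab t : a < t < b -> F t = K t.
  by move=> /andP[h1 h2]; rewrite (FE t 0) ?subr0 ?addr0 ?rpred0 //; lra.
(* Each period is mapped into itself, which settles monotonicity between points of different
   periods. *)
have Frange t : fl t + a <= F t < fl t + a + 1.
  have /andP[h1 h2] := flE t.
  have ha : K a <= K (t - fl t) by rewrite (le_mono iK); lra.
  have : K (t - fl t) < K (a + 1) by apply: iK; lra.
  by rewrite (sK (a + 1)) ?negb_and -?leNgt /F; lra.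
exists F; split => //.
- move=> t.
  have [h1 h2] : b - 1 + fl t < t /\ t < a + 1 + fl t by have := flE t; lra.
  have KF : K (u - fl t) + fl t @[u --> t] --> K (t - fl t) + fl t.
    apply: cvgD; last exact: cvg_cst.
    apply: (@continuous_comp _ _ _ (fun u => u - fl t) K); last exact: cK.
    by apply: cvgB; [exact: cvg_id|exact: cvg_cst].
  apply: cvg_trans KF; apply: near_eq_cvg; near=> u.
  rewrite (FE u (fl t)) //; apply/andP; split.
    by rewrite ltrBrDr; near: u; exact: lt_nbhsr.
  by rewrite ltrBlDr; near: u; exact: lt_nbhsl.
- move=> s t st.
  have /andP[h1 h2] := flE s; have /andP[h3 h4] := flE t.
  have [kf|fk|E] := ltgtP (fl s) (fl t).
  + have := intlt _ _ (fl_int s) (fl_int t) kf.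
    by have := Frange s; have := Frange t; lra.
  + by have := intlt _ _ (fl_int t) (fl_int s) fk; lra.
  + by rewrite /F E ltrD2r; apply: iK; rewrite ltrD2r.
- move=> t.
  rewrite (FE (t + 1) (fl t + 1)); last by have := flE t; lra.
    by rewrite /F (_ : t + 1 - (fl t + 1) = t - fl t); ring.
  by rewrite rpredD ?rpred1.
- move=> t; rewrite /F.
  have [h|h] := boolP (a < t - fl t < b).
    have /andP[h1 h2] := h; have := iK _ _ h1; have := iK _ _ h2.
    by rewrite Ka Kb ltr_norml; lra.
  by rewrite sK // subrK subrr normr0 subr_gt0.
Unshelve. all: by end_near. Qed.
End Interpolation.

(** * Approximation by homeomorphisms with prescribed values *)

Section Prescribed.
Variable R : realType.
Implicit Types (f g : homeo_plus R) (q e : R).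

(* f follows the rotation by q closely at r consecutive points, e apart. *)
Definition shadows q e r : set (homeo_plus R) := [set f | forall i, (i < r)%N ->
  circle_dist (homeo_fun f (circle_proj (e * i%:R))) (circle_proj (q + e * i%:R))
    < e / 2].

(** Finitely many strict inequalities, each stable under uniformly small changes of [f]. *)
Lemma open_shadows q e r : open (shadows q e r).
Proof.
rewrite openE => f /= fr; rewrite /interior.
pose near_i (i : 'I_r) : set (homeo_plus R) := [set g | circle_dist
  (homeo_fun g (circle_proj (e * i%:R))) (circle_proj (q + e * i%:R)) < e / 2].
have : \forall g \near f, forall i, near_i i g.
  apply: (@filter_forall _ _ near_i (nbhs f)) => i; apply/homeo_nbhsP.
  have := fr i (ltn_ord i); rewrite -subr_gt0 => d0.
  eexists; first exact: d0.
  move=> g fg; apply: le_lt_trans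
    (circle_dist_triangle (homeo_fun f (circle_proj (e * i%:R))) _ _) _.
  by have := fg (circle_proj (e * i%:R)); rewrite circle_dist_sym; lra.
by apply: filterS => g gr i ir; exact: (gr (Ordinal ir)).
Qed.

(* The location q and the scale l depend only on f and eps, so that r may be
   chosen afterwards as a function of an index of (q, l). *)
Lemma shadows_approx f eps : 0 < eps -> exists (q : rat) (l : nat), forall r,
  exists2 g, shadows (ratr q) (l.+2 * r)%:R^-1 r g &
    forall x, circle_dist (homeo_fun f x) (homeo_fun g x) < eps.
Proof.
move=> eps0; have [_ [F [cF iF F1 fF]]] := homeo_funP f.
(* The interpolation will use an interval of length [3 * eta]: below 1 for the periodic extension,
   below [eps] for the size of the perturbation. *)
pose eta := Num.min (eps / 4) 4^-1.
have eta0 : 0 < eta by rewrite lt_min !divr_gt0 //= invr_gt0.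
have [etae eta4] : eta <= eps / 4 /\ eta <= 4^-1.
  by split; rewrite ge_min lexx ?orbT.
have /cvgrPdist_lt/(_ _ eta0)/nbhs_ballP[d /= d0 dF] := cF 0.
pose dd := Num.min d eta.
have dd0 : 0 < dd by rewrite lt_min d0.
have [ddd dde] : dd <= d /\ dd <= eta by split; rewrite ge_min lexx ?orbT.
(* This confines all the points to [0, dd) whatever [r] is; their images then lie within [eta] of
   [F 0], and their targets within [2 * eta]. *)
have [l ldd] : exists l : nat, l.+1%:R^-1 < dd.
  have [l _ /(_ l (leqnn l))] := near_infty_natSinv_lt (PosNum dd0).
  by exists l.
have [q /andP[qF qFe]] : exists q : rat, F 0 < ratr q < F 0 + eta.
  have [|q] := @rat_in_itvoo R (F 0) (F 0 + eta); first by lra.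
  by rewrite in_itv /=; exists q.
exists q, l => r; set e : R := _^-1.
have e_ge0 : 0 <= e by rewrite invr_ge0.
have er i : (i < r)%N -> 0 < e /\ 0 <= e * i%:R < dd.
  move=> ir; have r0 : (0 < r)%N by apply: leq_ltn_trans ir.
  have ep : 0 < e by rewrite invr_gt0 ltr0n muln_gt0.
  split=> //.
  rewrite mulr_ge0 //=; apply: le_lt_trans ldd.
  rewrite /e natrM invfM -mulrA -[leRHS]mulr1.
  rewrite ler_pM ?invr_ge0 ?mulr_ge0 ?invr_ge0 //.
    by rewrite lef_pV2 ?posrE ?ltr0n // ler_nat.
  by rewrite ler_pdivrMl ?ltr0n // mulr1 ler_nat ltnW.
have y_range i : (i < r)%N -> F 0 <= F (e * i%:R) < F 0 + eta.
  move=> /er [ep /andP[ie0 ied]].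
  have : `|F 0 - F (e * i%:R)| < eta.
    by apply: dF; rewrite /ball /= sub0r normrN ger0_norm //; lra.
  have : F 0 <= F (e * i%:R) by rewrite (le_mono iF).
  by rewrite ltr_norml; lra.
have e_mono i j : (i < j < r)%N -> e * i%:R < e * j%:R.
  move=> /andP[ij /er [ep _]].
  by rewrite ltr_pM2l // ltr_nat.
(* The lifted images are moved exactly onto the targets, so the distances in [shadows] become 0. *)
have [i /y_range||i j /e_mono/iF//|i j /e_mono|K hK Ky] :=
    @supported_homeo_interpolation R r (F 0 - eta) (F 0 + 2 * eta)
      (fun i => F (e * i%:R)) (fun i => ratr q + e * i%:R).
- by lra.
- by move=> i /er[_]; lra.
- by rewrite ltrD2l.
have [|G [cG iG G1 GK Gid]] := supported_homeo_periodic _ hK; first by lra.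
have [k kG] := lift_homeo_plus cG iG G1.
exists (k * f)%g.
  move=> i ir; rewrite homeo_funM /= -fF kG GK; last by have := y_range i ir; lra.
  have [ep _] := er i ir.
  by rewrite Ky // circle_distxx divr_gt0.
move=> x; have [t <-] := circle_proj_surj x.
rewrite homeo_funM /= -fF kG; apply: le_lt_trans (circle_dist_proj_le _ _) _.
by rewrite distrC; have := Gid (F t); lra.
Qed.

End Prescribed.

(** * Translation invariance of Lebesgue measure, and the measurable family of rotations *)

Section Rotations.
Variable R : realType.
Local Notation mu := (@lebesgue_measure R).

(** By uniqueness of Lebesgue measure: its pushforward under a shift also gives half-open intervals
    their length. *)
Lemma lebesgue_measure_shift (t : R) (A : set R) : measurable A ->
  mu ((fun s => s + t) @^-1` A) = mu A.
Proof.
move=> mA.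
have ms : @measurable_fun _ _ (measurableTypeR R) (measurableTypeR R) setT
    (fun s => s + t).
  apply: continuous_measurable_fun => s.
  by apply: cvgD; [exact: cvg_id|exact: cvg_cst].
pose shift : {mfun measurableTypeR R >-> measurableTypeR R} :=
  HB.pack (fun s : R => s + t) (isMeasurableFun.Build _ _ _ _ _ ms).
rewrite [RHS](@lebesgue_measure_unique _ (pushforward mu shift)) //.
move=> _ [[a b] _ <-]; rewrite /pushforward [RHS](_ : _ = mu `]a - t, b - t]); last first.
  congr (mu _); apply/seteqP.
  by split=> s; rewrite /= !in_itv /= ltrBlDr lerBrDr.
rewrite !lebesgue_measure_itv /= !lte_fin ltrD2r.
by case: ifP => // _; rewrite -!EFinB; congr _%:E; ring.
Qed.

Lemma rotation_ex (t : R) : exists f : homeo_plus R,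
  forall s, homeo_fun f (circle_proj s) = circle_proj (s + t).
Proof.
apply: lift_homeo_plus.
- by move=> s; apply: cvgD; [exact: cvg_id|exact: cvg_cst].
- by move=> s s' ss'; rewrite ltrD2r.
- by move=> s; rewrite addrAC.
Qed.

Definition rotation (t : R) : homeo_plus R := sval (cid (rotation_ex t)).

Lemma rotationE t s : homeo_fun (rotation t) (circle_proj s) = circle_proj (s + t).
Proof. exact: svalP (cid (rotation_ex t)) s. Qed.

Lemma rotation_continuous : continuous rotation.
Proof.
move=> t U /homeo_nbhsP[e e0 eU]; apply/nbhs_ballP; exists e => //= s ts.
apply: eU => x; have [u <-] := circle_proj_surj x.
rewrite !rotationE; apply: le_lt_trans (circle_dist_proj_le _ _) _.
by rewrite opprD addrACA subrr add0r.
Qed.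

(** Needed to form the law of a random rotation; continuity is enough because open sets generate the
    Borel sets. *)
Lemma measurable_rotation :
  measurable_fun [set: measurableTypeR R] (rotation : _ -> homeo_borel R).
Proof.
apply: (@measurability _ _ (measurableTypeR R) (homeo_borel R) setT rotation
  (@open (homeo_plus R))) => //.
move=> _ [U oU <-]; rewrite setTI; apply: open_measurable.
by have /continuousP := rotation_continuous; apply.
Qed.

End Rotations.

(** * Probability that a random rotation hits disjoint targets *)

Section Hits.
Variable R : realType.
Local Notation mu := (@lebesgue_measure R).
Implicit Types (g h k : homeo_plus R) (q e : R).

Section DisjointTargets.
Variables (k : homeo_plus R) (t : nat -> R) (U : nat -> set (circle R)) (r : nat).
Hypothesis t01 : forall i, (i < r)%N -> 0 <= t i <= 1.
Hypothesis oU : forall i, open (U i).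

(** Here [u] is the rotation angle; in the application [k] is the left factor of the translate and
    [t i] lifts the image of the [i]-th point under the right factor. *)
Definition hits : set R := [set u | 0 <= u <= 1 /\
  forall i, (i < r)%N -> U i (homeo_fun k (circle_proj (t i + u)))].

Let V i : set R := (homeo_fun k \o @circle_proj R) @^-1` U i.

Let oV i : open (V i).
Proof.
have [[ck _] _] := homeo_funP k.
have c : continuous (homeo_fun k \o @circle_proj R).
  by move=> s; apply: continuous_comp; [exact: circle_proj_continuous|exact: ck].
by move/continuousP: c; apply.
Qed.

Lemma measurable_hits : measurable hits.
Proof.
rewrite (_ : hits =
  `[0, 1]%classic `&` \bigcap_(i in `I_r) ((fun u => u + t i) @^-1` V i)).
  apply: measurableI => //; apply: bigcap_measurableType => // i _.
  apply: open_measurable.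
  have c : continuous (fun u => u + t i).
    by move=> s; apply: cvgD; [exact: cvg_id|exact: cvg_cst].
  by move/continuousP: c; apply.
apply/seteqP; split=> u; rewrite /hits /= in_itv /= => -[u01 h]; split => // i ir.
  by rewrite /= /V /= addrC; exact: h.
by have := h i ir; rewrite /V /= addrC.
Qed.

(** For each [i], the shift by [t i] maps [hits] into [W i]; these [r] sets are disjoint inside
    [0, 2]. *)
Lemma disjoint_hits_measure : trivIset `I_r U -> (r%:R%:E * mu hits <= 2%:E)%E.
Proof.
move=> tU; pose W i := `[0, 2]%classic `&` V i.
have mW i : measurable (W i).
  by apply: measurableI => //; exact: open_measurable.
(* As t i + u lies in [0, 2], no reduction modulo 1 is needed. *)
have hW i : (i < r)%N -> (mu hits <= mu (W i))%E.
  move=> ir; rewrite -(lebesgue_measure_shift (t i) (mW i)).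
  have ms : measurable ((fun u => u + t i) @^-1` W i).
    have := @continuous_measurable_fun R (fun u => u + t i).
    rewrite -[X in measurable X]setTI; apply => //.
    by move=> s; apply: cvgD; [exact: cvg_id|exact: cvg_cst].
  apply: le_measure; rewrite ?inE //; first exact: measurable_hits.
  move=> u [u01 hu]; split; last by rewrite /V /= addrC; exact: hu.
  by rewrite /= in_itv /=; have := t01 ir; lra.
have tW : trivIset `I_r W.
  move=> i j ir jr [s [[_ si] [_ sj]]]; apply: tU => //.
  by exists (homeo_fun k (circle_proj s)).
apply: (@le_trans _ _ (\sum_(i < r) mu (W i))%E).
  rewrite (_ : r%:R%:E * mu hits = \sum_(i < r) mu hits)%E.
    by apply: lee_sum => i _; exact: hW.
  by rewrite sumr_const card_ord mule_natl.
have mUW : measurable (\big[setU/set0]_(i < r) W i).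
  by apply: bigsetU_measurable => i _.
rewrite -measure_semi_additive_ord_I //; last by move=> i _; exact: mW.
apply: (@le_trans _ _ (mu `[0, 2])).
  apply: le_measure; rewrite ?inE //.
  by rewrite -bigcup_mkord; apply: bigcup_sub => i _ s [].
by rewrite lebesgue_measure_itv /= lte_fin ltr0n /= sube0.
Qed.

End DisjointTargets.

(** A common point would put two centres less than [e] apart on the circle. Their given lifts are at
    least [e] apart, and too close together for an integer translation to help. *)
Lemma trivIset_circle_balls q e r : 0 < e -> e * r%:R <= 2^-1 ->
  trivIset `I_r (fun i => [set x | circle_dist x (circle_proj (q + e * i%:R)) < e / 2]).
Proof.
move=> e0 er i j.
wlog ij : i j / (i <= j)%N.
  move=> H ir jr [x [xi xj]]; have [ij|/ltnW ji] := leqP i j.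
    by apply: H => //; exists x.
  by apply/esym/H => //; exists x.
move=> _ /= jr [x [/= xi xj]]; apply/eqP; rewrite eqn_leq ij /= leqNgt.
apply/negP => {}ij.
have : circle_dist (circle_proj (q + e * i%:R)) (circle_proj (q + e * j%:R)) < e.
  by apply: le_lt_trans (circle_dist_triangle x _ _) _; rewrite circle_dist_sym; lra.
move=> /circle_dist_projP[s /circle_projP sj si].
have eS n : e * n%:R + e = e * n.+1%:R by rewrite -natr1 mulrDr mulr1.
have eij : e * i%:R + e <= e * j%:R by rewrite eS ler_pM2l // ler_nat.
have ej : e * j%:R + e <= e * r%:R by rewrite eS ler_pM2l // ler_nat.
have ei : 0 <= e * i%:R by rewrite mulr_ge0 // ltW.
(* This difference is an integer, and its absolute value is below [e * r], hence below 1. *)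
have [s0|s0] := eqVneq (s - (q + e * j%:R)) 0.
  by move: si; rewrite ltr_norml; lra.
have := norm_intr_ge1 sj s0; rewrite leNgt => /negP; apply.
by move: si; rewrite !ltr_norml; lra.
Qed.

(** The factor [l.+2] makes the spacing times [r] at most 1/2, so the targets are disjoint; the
    resulting bound 2/r is uniform in [g], [h], [q] and [l]. *)
Lemma translate_shadows_measure g h q l r : (0 < r)%N ->
  let A := [set u | 0 <= u <= 1 /\
    shadows q (l.+2 * r)%:R^-1 r (g * rotation u * h)%g] in
  measurable A /\ (r%:R%:E * lebesgue_measure A <= 2%:E)%E.
Proof.
move=> r0; set e : R := _^-1; move=> A.
have e0 : 0 < e by rewrite invr_gt0 ltr0n muln_gt0.
have er : e * r%:R <= 2^-1.
  rewrite /e natrM invfM -mulrA mulVf ?pnatr_eq0 -?lt0n // mulr1.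
  by rewrite lef_pV2 ?posrE ?ltr0n // ler_nat.
have /choice[t tE] : forall i : nat, exists s : R, 0 <= s <= 1 /\
    circle_proj s = homeo_fun h (circle_proj (e * i%:R)).
  move=> i.
  have [s sE s01] := circle_proj_window 0 (homeo_fun h (circle_proj (e * i%:R))).
  by exists s; split => //; lra.
pose U i := [set x : circle R | circle_dist x (circle_proj (q + e * i%:R)) < e / 2].
have oU i : open (U i).
  rewrite openE => x xU; apply/nbhs_ballP.
  have d0 : 0 < e / 2 - circle_dist x (circle_proj (q + e * i%:R)).
    by rewrite subr_gt0.
  eexists; first exact: d0.
  move=> y /= xy; apply: le_lt_trans (circle_dist_triangle x _ _) _.
  by rewrite circle_dist_sym -ltrBrDr.
have -> : A = hits g t U r.
  apply/seteqP; split=> u [u01 hu]; split => // i ir.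
    by have := hu i ir; rewrite !homeo_funM /= -(tE i).2 rotationE.
  by rewrite !homeo_funM /= -(tE i).2 rotationE; exact: hu.
split; first exact: measurable_hits.
apply: disjoint_hits_measure => //; last exact: trivIset_circle_balls.
by move=> i _; have [] := tE i.
Qed.

End Hits.

(** * The comeagre Haar null set *)

Section Partition.
Variable R : realType.
Implicit Types (f g h : homeo_plus R).

(* Numbers that encode no pair yield the arbitrary configuration (0, 0). *)
Definition shadow_code (p : nat) : rat * nat :=
  odflt (0, 0%N) (unpickle p : option (rat * nat)%type).

(** Chosen so that the bound 2/r equals 2^-n times 2^-(p+1), whose sum over [p] is 2^-n. *)
Definition shadow_count (n p : nat) : nat := (2 ^ (n + p).+2)%N.

Definition shadow_open (n p : nat) : set (homeo_plus R) :=
  let: (q, l) := shadow_code p in let r := shadow_count n p in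
  shadows (ratr q) (l.+2 * r)%:R^-1 r.

Lemma open_shadow_open n p : open (shadow_open n p).
Proof. by rewrite /shadow_open; case: shadow_code => *; exact: open_shadows. Qed.

Definition shadow_set : set (homeo_plus R) :=
  \bigcap_n \bigcup_p shadow_open n p.

Lemma measurable_shadow_set : measurable (shadow_set : set (homeo_borel R)).
Proof.
apply: bigcapT_measurable => n; apply: sub_sigma_algebra.
by apply: bigcup_open => p _; exact: open_shadow_open.
Qed.

Lemma nowhere_dense_setC_shadow_open n :
  nowhere_dense (~` \bigcup_p shadow_open n p).
Proof.
rewrite /nowhere_dense -(closure_id _).1; last first.
  by apply: open_closedC; apply: bigcup_open => p _; exact: open_shadow_open.
rewrite -subset0 => f /homeo_nbhsP[e e0 fe].
have [q [l ql]] := shadows_approx f e0.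
(* The code of the pair determines the number of points, which is why [q] and [l] had to be found
   before [r]. *)
have [g gS fg] := ql (shadow_count n (pickle (q, l))).
apply: (fe _ fg); exists (pickle (q, l)); first exact: I.
by rewrite /shadow_open /shadow_code pickleK.
Qed.

Lemma meagre_setC_shadow_set : meagre (~` shadow_set).
Proof.
exists (fun n => ~` \bigcup_p shadow_open n p); last by rewrite setC_bigcap.
exact: nowhere_dense_setC_shadow_open.
Qed.

(** For every [n] the sets [B n p] cover [A], and their measures sum to at most 2^-n. *)
Lemma rotation_shadow_set_negligible g h :
  let A := [set u | shadow_set (g * rotation u * h)%g] `&` `[0, 1]%classic in
  measurable A /\ lebesgue_measure A = 0%E.
Proof.
move=> A.
pose B n p := [set u | 0 <= u <= 1 /\ shadow_open n p (g * rotation u * h)%g].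
have AE : A = \bigcap_n \bigcup_p B n p.
  apply/seteqP; split=> [u [uN]|u uB].
    by rewrite /= in_itv /= => u01 n _; have [p _ up] := uN n I; exists p.
  split; last by have [p _ []] := uB 0%N I; rewrite /= in_itv.
  by move=> n _; have [p _ [_ up]] := uB n I; exists p.
have [mB muB] : (forall n p, measurable (B n p)) /\ forall n p,
    (lebesgue_measure (B n p) <= (2^-1 ^+ n / (2 ^ p.+1)%:R)%:E)%E.
  suff mBle n p : measurable (B n p) /\
      ((shadow_count n p)%:R%:E * lebesgue_measure (B n p) <= 2%:E)%E.
    split=> n p; have [//] := mBle n p.
    move=> _; rewrite -lee_pdivlMl ?ltr0n ?expn_gt0 //.
    move/le_trans; apply; rewrite -EFinM lee_fin.
    rewrite /shadow_count -addSn -addnS !natrX exprD exprS exprVn.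
    by rewrite invfM invfM mulrC !mulrA mulfV // mul1r.
  have r0 : (0 < shadow_count n p)%N by rewrite expn_gt0.
  rewrite /B /shadow_open; case: shadow_code => q l.
  exact: translate_shadows_measure.
have mA : measurable A.
  by rewrite AE; apply: bigcapT_measurable => n; exact: bigcupT_measurable.
split => //; apply/eqP; rewrite eq_le measure_ge0 andbT.
have Ale n : (lebesgue_measure A <= (2^-1 ^+ n)%:E)%E.
  apply: (@le_trans _ _ (\sum_(p <oo) lebesgue_measure (B n p))%E).
    apply: measure_sigma_subadditive => //; first exact: mB.
    by rewrite AE => u uB; exact: uB.
  apply: le_trans (epsilon_trick0 xpredT _); last by rewrite exprn_ge0.
  by apply: lee_nneseries => // p _; exact: muB.
apply/lee_addgt0Pr => e e0; rewrite add0e.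
have [n _ /(_ n (leqnn n)) ne] := near_infty_natSinv_expn_lt (PosNum e0).
by apply: le_trans (Ale n) _; rewrite lee_fin exprVn ltW // -div1r.
Qed.

Lemma haar_null_shadow_set : haar_null shadow_set.
Proof.
exists shadow_set => //; split; first exact: measurable_shadow_set.
pose rot : {mfun measurableTypeR R >-> homeo_borel R} :=
  HB.pack (@rotation R) (isMeasurableFun.Build _ _ _ _ _ (@measurable_rotation R)).
(* The witness is the law of the rotation by a uniform angle in [0, 1]. *)
exists (distribution (uniform_prob (@ltr01 R)) rot) => g h.
rewrite /distribution /pushforward /= /uniform_prob integral_uniform_pdf.
(* A rotation lies in the translate by [g] and [h] exactly when its own translate by the inverses
   lies in [shadow_set]. Absolute continuity of the uniform law then transfers the Lebesgue null
   set. *)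
have [mA A0] := rotation_shadow_set_negligible g^-1%g h^-1%g.
rewrite (_ : _ `&` _ = [set u | shadow_set (g^-1 * rotation u * h^-1)%g] `&` `[0, 1]).
  have /null_content_dominatesP := dominates_uniform_prob (@ltr01 R).
  exact.
congr (_ `&` _); apply/seteqP; split=> u.
  by move=> [f fN /= <-]; rewrite /= !mulgA mulVg mul1g mulgK.
move=> uN; exists (g^-1 * rotation u * h^-1)%g => //.
by rewrite !mulgA mulgV mul1g mulgVK.
Qed.

End Partition.

Theorem corollary6p2 (R : realType) :
  exists N M : set (homeo_plus R),
    [/\ N `|` M = [set: homeo_plus R], N `&` M = set0,
        haar_null N & meagre M].
Proof.
exists (@shadow_set R), (~` @shadow_set R).
split; [exact: setUv|exact: setICr|exact: haar_null_shadow_set|].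
exact: meagre_setC_shadow_set.
Qed.
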